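(* Let $(G_2)^\gamma=\{\alpha\in G_2\mid\gamma\alpha=\alpha\gamma\}$. Then there is an isomorphism of groups $$(G_2)^\gamma\cong (Sp(1)\times Sp(1))/\mathbb Z_2,\qquad \mathbb Z_2=\{(1,1),(-1,-1)\}.$$
   Context: $\mathbb H$ is the field of quaternions with basis $1,e_1,e_2,e_3$; the Cayley algebra is $\mathfrak C=\mathbb H\oplus\mathbb He_4$ with multiplication $(m+ae_4)(n+be_4)=(mn-\overline b a)+(a\overline n+bm)e_4$. $G_2$ is the group of $\mathbb R$-linear isomorphisms $\alpha$ of $\mathfrak C$ with $\alpha(xy)=(\alpha x)(\alpha y)$. The involution $\gamma:\mathfrak C\to\mathfrak C$ is $\gamma(m+ae_4)=m-ae_4$ (it lies in $G_2$). $Sp(1)$ is the group of unit quaternions. *)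

(* Defs.v *)
From HB Require Import structures.
From mathcomp Require Import all_boot all_order all_algebra.
From mathcomp Require Import ring.
From mathcomp Require Import boolp reals.

Set Implicit Arguments.
Unset Strict Implicit.
Unset Printing Implicit Defensive.

Import GRing.Theory Num.Theory.
Local Open Scope ring_scope.

(* [Quat a b c d] is a + b e1 + c e2 + d e3. *)
Record quat (R : realType) := Quat { q0 : R; q1 : R; q2 : R; q3 : R }.

Section Quaternions.
Variable R : realType.
Implicit Types x y z : quat R.

Definition quat_to_tuple x := (q0 x, q1 x, q2 x, q3 x).
Definition quat_of_tuple (t : R * R * R * R) :=
  let: (a, b, c, d) := t in Quat a b c d.
Lemma quat_to_tupleK : cancel quat_to_tuple quat_of_tuple.
Proof. by case. Qed.

HB.instance Definition _ := Choice.copy (quat R) (can_type quat_to_tupleK).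

Definition quat_zero : quat R := Quat 0 0 0 0.
Definition quat_opp x := Quat (- q0 x) (- q1 x) (- q2 x) (- q3 x).
Definition quat_add x y :=
  Quat (q0 x + q0 y) (q1 x + q1 y) (q2 x + q2 y) (q3 x + q3 y).

Lemma quat_addA : associative quat_add.
Proof. by move=> [? ? ? ?] [? ? ? ?] [? ? ? ?]; rewrite /quat_add /= !addrA. Qed.
Lemma quat_addC : commutative quat_add.
Proof.
by move=> [a b c d] [a' b' c' d']; congr Quat; rewrite /= addrC.
Qed.
Lemma quat_add0 : left_id quat_zero quat_add.
Proof. by move=> [? ? ? ?]; rewrite /quat_add /= !add0r. Qed.
Lemma quat_addN : left_inverse quat_zero quat_opp quat_add.
Proof. by move=> [? ? ? ?]; rewrite /quat_add /= !addNr. Qed.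

HB.instance Definition _ :=
  GRing.isZmodule.Build (quat R) quat_addA quat_addC quat_add0 quat_addN.

(* e1 e2 = e3, e2 e3 = e1, e3 e1 = e2, ei ei = -1, ei ej = - ej ei *)
Definition quat_one : quat R := Quat 1 0 0 0.
Definition quat_mul x y := Quat
  (q0 x * q0 y - q1 x * q1 y - q2 x * q2 y - q3 x * q3 y)
  (q0 x * q1 y + q1 x * q0 y + q2 x * q3 y - q3 x * q2 y)
  (q0 x * q2 y - q1 x * q3 y + q2 x * q0 y + q3 x * q1 y)
  (q0 x * q3 y + q1 x * q2 y - q2 x * q1 y + q3 x * q0 y).

Lemma quat_mulA : associative quat_mul.
Proof.
by move=> [? ? ? ?] [? ? ? ?] [? ? ? ?]; rewrite /quat_mul /=; congr Quat; ring.
Qed.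
Lemma quat_mul1q : left_id quat_one quat_mul.
Proof. by move=> [? ? ? ?]; rewrite /quat_mul /=; congr Quat; ring. Qed.
Lemma quat_mulq1 : right_id quat_one quat_mul.
Proof. by move=> [? ? ? ?]; rewrite /quat_mul /=; congr Quat; ring. Qed.
Lemma quat_mulDl : left_distributive quat_mul quat_add.
Proof.
by move=> [? ? ? ?] [? ? ? ?] [? ? ? ?]; rewrite /quat_mul /quat_add /=;
  congr Quat; ring.
Qed.
Lemma quat_mulDr : right_distributive quat_mul quat_add.
Proof.
by move=> [? ? ? ?] [? ? ? ?] [? ? ? ?]; rewrite /quat_mul /quat_add /=;
  congr Quat; ring.
Qed.
Lemma quat_oner_neq0 : quat_one != 0.
Proof. by apply/eqP => -[/eqP]; rewrite oner_eq0. Qed.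

HB.instance Definition _ := GRing.Zmodule_isNzRing.Build (quat R)
  quat_mulA quat_mul1q quat_mulq1 quat_mulDl quat_mulDr quat_oner_neq0.

Definition quat_scale (k : R) x := Quat (k * q0 x) (k * q1 x) (k * q2 x) (k * q3 x).

Lemma quat_scaleA k l x : quat_scale k (quat_scale l x) = quat_scale (k * l) x.
Proof. by rewrite /quat_scale /= !mulrA. Qed.
Lemma quat_scale1 : left_id 1 quat_scale.
Proof. by move=> [? ? ? ?]; rewrite /quat_scale /= !mul1r. Qed.
Lemma quat_scaleDr : right_distributive quat_scale +%R.
Proof. by move=> k x y; rewrite /quat_scale /= !mulrDr. Qed.
Lemma quat_scaleDl x : {morph quat_scale^~ x : k l / k + l}.
Proof. by move=> k l; rewrite /quat_scale /= !mulrDl. Qed.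

HB.instance Definition _ := GRing.Zmodule_isLmodule.Build R (quat R)
  quat_scaleA quat_scale1 quat_scaleDr quat_scaleDl.

Definition quat_conj x := Quat (q0 x) (- q1 x) (- q2 x) (- q3 x).

Definition quat_norm x : R :=
  Num.sqrt (q0 x ^+ 2 + q1 x ^+ 2 + q2 x ^+ 2 + q3 x ^+ 2).

Lemma quat_norm1P x : reflect (x * quat_conj x = 1) (quat_norm x == 1).
Proof.
case: x => a b c d; rewrite /quat_norm /=.
apply: (iffP eqP) => [h | [h _ _ _]].
  have : a ^+ 2 + b ^+ 2 + c ^+ 2 + d ^+ 2 = 1.
    by rewrite -[LHS]sqr_sqrtr ?h ?expr1n // !addr_ge0 ?sqr_ge0.
  by move=> h2; congr Quat => /=; rewrite -?h2; ring.
by rewrite -[RHS]sqrtr1; congr Num.sqrt; rewrite -h; ring.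
Qed.

Lemma quat_conjM x y : quat_conj (x * y) = quat_conj y * quat_conj x.
Proof. by case: x y => [? ? ? ?] [? ? ? ?]; congr Quat => /=; ring. Qed.
Lemma quat_conjK : involutive quat_conj.
Proof. by case=> *; rewrite /quat_conj /= !opprK. Qed.
Lemma quat_norm_conj x : quat_norm (quat_conj x) = quat_norm x.
Proof. by rewrite /quat_norm /= !sqrrN. Qed.

End Quaternions.

Record sp1 (R : realType) := Sp1 { sp1_val : quat R; _ : quat_norm sp1_val == 1 }.

Section SpOne.
Variable R : realType.
Implicit Types u v w : sp1 R.

HB.instance Definition _ := [isSub for @sp1_val R].
HB.instance Definition _ := [Choice of sp1 R by <:].

Lemma sp1_one_subproof : quat_norm (1 : quat R) == 1.
Proof. by apply/quat_norm1P; congr Quat => /=; ring. Qed.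
Lemma sp1_mul_subproof u v : quat_norm (val u * val v) == 1.
Proof.
apply/quat_norm1P; rewrite quat_conjM mulrA -(mulrA (val u)).
by rewrite (elimT (quat_norm1P _) (valP v)) mulr1; apply/quat_norm1P; exact: (valP u).
Qed.
Lemma sp1_inv_subproof u : quat_norm (quat_conj (val u)) == 1.
Proof. by rewrite quat_norm_conj; exact: (valP u). Qed.

Definition sp1_one := Sp1 sp1_one_subproof.
Definition sp1_mul u v := Sp1 (sp1_mul_subproof u v).
Definition sp1_inv u := Sp1 (sp1_inv_subproof u).

Lemma sp1_mulA : associative sp1_mul.
Proof. by move=> u v w; apply/val_inj; rewrite /= mulrA. Qed.
Lemma sp1_mul1 : left_id sp1_one sp1_mul.
Proof. by move=> u; apply/val_inj; rewrite /= mul1r. Qed.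
Lemma sp1_mulu1 : right_id sp1_one sp1_mul.
Proof. by move=> u; apply/val_inj; rewrite /= mulr1. Qed.
Lemma sp1_mulVu : left_inverse sp1_one sp1_inv sp1_mul.
Proof.
move=> u; apply/val_inj => /=.
by rewrite -[X in _ * X]quat_conjK; apply/quat_norm1P; exact: sp1_inv_subproof.
Qed.
Lemma sp1_muluV : right_inverse sp1_one sp1_inv sp1_mul.
Proof. by move=> u; apply/val_inj; apply/quat_norm1P; exact: (valP u). Qed.

HB.instance Definition _ := isGroup.Build (sp1 R)
  sp1_mulA sp1_mul1 sp1_mulu1 sp1_mulVu sp1_muluV.

End SpOne.

(* The pair (m, a) stands for m + a e4.  The multiplication is cayley_mul,
   not the componentwise product that the library puts on pairs of rings. *)
Definition cayley (R : realType) := (quat R * quat R)%type.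

HB.instance Definition _ (R : realType) := GRing.Lmodule.on (cayley R).

Section Cayley.
Variable R : realType.

Definition cayley_mul (x y : cayley R) : cayley R :=
  let: (m, a) := x in let: (n, b) := y in
  (m * n - quat_conj b * a, a * quat_conj n + b * m).

Definition gamma (x : cayley R) : cayley R := let: (m, a) := x in (m, - a).

Definition is_G2 (f : cayley R -> cayley R) : Prop :=
  [/\ linear f, bijective f &
      forall x y, f (cayley_mul x y) = cayley_mul (f x) (f y)].

Lemma gamma_G2 : is_G2 gamma.
Proof.
split.
- by move=> k [m a] [n b]; congr pair => /=; rewrite opprD scalerN.
- by exists gamma; case=> m a; rewrite /= opprK.
- case=> m a [n b] /=; congr pair; last by rewrite opprD !mulNr.
  have -> : quat_conj (- b) = - quat_conj b by case: b.
  by rewrite mulrNN.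
Qed.

End Cayley.

Record G2 (R : realType) :=
  MkG2 { G2_fun :> cayley R -> cayley R; _ : `[< is_G2 G2_fun >] }.

Section G2Group.
Variable R : realType.
Implicit Types f g h : G2 R.

HB.instance Definition _ := [isSub for @G2_fun R].
HB.instance Definition _ := [Choice of G2 R by <:].

Lemma G2P f : is_G2 f.
Proof. exact/asboolP/(valP f). Qed.

Lemma G2_eq f g : f =1 g -> f = g.
Proof. by move=> e; apply/val_inj/funext. Qed.

Lemma G2_one_subproof : `[< is_G2 (@id (cayley R)) >].
Proof. by apply/asboolP; split=> //; exists id. Qed.

Lemma G2_mul_subproof f g : `[< is_G2 (f \o g) >].
Proof.
apply/asboolP; have [fl fb fM] := G2P f; have [gl gb gM] := G2P g; split.
- by move=> k x y; rewrite /= gl fl.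
- exact: bij_comp.
- by move=> x y; rewrite /= gM fM.
Qed.

Lemma G2_inv_ex f : exists g : cayley R -> cayley R, cancel f g /\ cancel g f.
Proof. by have [_ [g fg gf] _] := G2P f; exists g. Qed.

Definition G2_inv_fun f := sval (cid (G2_inv_ex f)).

Lemma G2_invK f : cancel f (G2_inv_fun f).
Proof. by rewrite /G2_inv_fun; case: cid => g []. Qed.
Lemma G2_invKV f : cancel (G2_inv_fun f) f.
Proof. by rewrite /G2_inv_fun; case: cid => g []. Qed.

Lemma G2_inv_subproof f : `[< is_G2 (G2_inv_fun f) >].
Proof.
apply/asboolP; have [fl _ fM] := G2P f.
have fI := can_inj (G2_invK f); split.
- by move=> k x y; apply: fI; rewrite fl !G2_invKV.
- by exists f; [exact: G2_invKV | exact: G2_invK].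
- by move=> x y; apply: fI; rewrite fM !G2_invKV.
Qed.

Definition G2_one := MkG2 G2_one_subproof.
Definition G2_mul f g := MkG2 (G2_mul_subproof f g).
Definition G2_inv f := MkG2 (G2_inv_subproof f).

Lemma G2_mulA : associative G2_mul.
Proof. by move=> f g h; apply: G2_eq. Qed.
Lemma G2_mul1 : left_id G2_one G2_mul.
Proof. by move=> f; apply: G2_eq. Qed.
Lemma G2_mulf1 : right_id G2_one G2_mul.
Proof. by move=> f; apply: G2_eq. Qed.
Lemma G2_mulVf : left_inverse G2_one G2_inv G2_mul.
Proof. by move=> f; apply: G2_eq; exact: G2_invK. Qed.
Lemma G2_mulfV : right_inverse G2_one G2_inv G2_mul.
Proof. by move=> f; apply: G2_eq; exact: G2_invKV. Qed.

HB.instance Definition _ := isGroup.Build (G2 R)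
  G2_mulA G2_mul1 G2_mulf1 G2_mulVf G2_mulfV.

Definition commutes_gamma : {pred G2 R} :=
  fun f => `[< @gamma R \o f = f \o @gamma R >].

Lemma commutes_gamma_closed : group_closed commutes_gamma.
Proof.
split; first exact/asboolP.
move=> f g /asboolP/funeqP hf /asboolP/funeqP hg; apply/asboolP/funext => x /=.
rewrite [LHS](hf _); congr (f _).
apply: (can_inj (G2_invK g)); rewrite -[LHS](hg _) /=.
by rewrite !G2_invKV.
Qed.

End G2Group.

Record G2gamma (R : realType) := MkG2gamma {
  G2gamma_val :> G2 R; _ : G2gamma_val \in @commutes_gamma R }.

HB.instance Definition _ (R : realType) := [isSub for @G2gamma_val R].
HB.instance Definition _ (R : realType) := [Choice of G2gamma R by <:].
HB.instance Definition _ (R : realType) :=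
  SubChoice_isSubGroup.Build (G2 R) _ (G2gamma R) (@commutes_gamma_closed R).

Record normal_subgroup (G : groupType) := NormalSubgroup {
  nsub_pred :> {pred G};
  nsub_closed : group_closed nsub_pred;
  nsub_conj : forall x y : G, x \in nsub_pred -> (x ^ y)%g \in nsub_pred }.

Section QuotientGroup.
Variables (G : groupType) (N : normal_subgroup G).
Local Open Scope group_scope.
Local Open Scope quotient_scope.

Definition coset_rel : rel G := fun x y => x^-1 * y \in nsub_pred N.

Lemma nsub1 : 1 \in nsub_pred N.
Proof. by case: (nsub_closed N). Qed.
Lemma nsubF x y : x \in nsub_pred N -> y \in nsub_pred N -> x / y \in nsub_pred N.
Proof. by case: (nsub_closed N) => _; apply. Qed.
Lemma nsubV x : x \in nsub_pred N -> x^-1 \in nsub_pred N.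
Proof. by move=> Nx; rewrite -[_^-1]mul1g nsubF ?nsub1. Qed.
Lemma nsubM x y : x \in nsub_pred N -> y \in nsub_pred N -> x * y \in nsub_pred N.
Proof. by move=> Nx Ny; rewrite -[y]invgK nsubF ?nsubV. Qed.

Lemma coset_rel_refl : reflexive coset_rel.
Proof. by move=> x; rewrite /coset_rel mulVg nsub1. Qed.
Lemma coset_rel_sym : symmetric coset_rel.
Proof.
by move=> x y; rewrite /coset_rel; apply/idP/idP => /nsubV;
  rewrite invgM invgK.
Qed.
Lemma coset_rel_trans : transitive coset_rel.
Proof.
by move=> y x z hxy hyz; move: (nsubM hxy hyz); rewrite mulgA mulgK.
Qed.

Canonical coset_equiv :=
  EquivRel coset_rel coset_rel_refl coset_rel_sym coset_rel_trans.

Definition quotg := {eq_quot coset_equiv}.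

HB.instance Definition _ := Choice.on quotg.
HB.instance Definition _ := EqQuotient.on quotg.

Lemma quotg_eqP x y : reflect (x = y %[mod quotg]) (x^-1 * y \in nsub_pred N).
Proof. exact: (@eqmodP G coset_equiv). Qed.

Definition quotg_mul := lift_op2 quotg (fun x y : G => x * y).
Definition quotg_one : quotg := \pi 1.
Definition quotg_inv := lift_op1 quotg (fun x : G => x^-1).

Lemma pi_quotg_mul : {morph \pi_quotg : x y / x * y >-> quotg_mul x y}.
Proof.
move=> x y; unlock quotg_mul; apply/quotg_eqP.
have /quotg_eqP hx : x = repr (\pi_quotg x) %[mod quotg] by rewrite reprK.
have /quotg_eqP hy : y = repr (\pi_quotg y) %[mod quotg] by rewrite reprK.
set x' := repr _ in hx *; set y' := repr _ in hy *.
have -> : (x * y)^-1 * (x' * y') = ((x^-1 * x') ^ y) * (y^-1 * y').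
  by rewrite invgM conjgE !mulgA mulgK.
by apply: nsubM => //; apply: nsub_conj.
Qed.

Lemma pi_quotg_inv : {morph \pi_quotg : x / x^-1 >-> quotg_inv x}.
Proof.
move=> x; unlock quotg_inv; apply/quotg_eqP.
have /quotg_eqP hx : x = repr (\pi_quotg x) %[mod quotg] by rewrite reprK.
set x' := repr _ in hx *.
have -> : x^-1^-1 * x'^-1 = (x^-1 * x')^-1 ^ x^-1.
  by rewrite invgM conjgE !invgK !mulgA mulgK.
by apply/nsub_conj/nsubV.
Qed.

Lemma quotg_mulA : associative quotg_mul.
Proof.
by elim/quotW=> x; elim/quotW=> y; elim/quotW=> z; rewrite -!pi_quotg_mul mulgA.
Qed.
Lemma quotg_mul1 : left_id quotg_one quotg_mul.
Proof. by elim/quotW=> x; rewrite -pi_quotg_mul mul1g. Qed.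
Lemma quotg_mulx1 : right_id quotg_one quotg_mul.
Proof. by elim/quotW=> x; rewrite -pi_quotg_mul mulg1. Qed.
Lemma quotg_mulVx : left_inverse quotg_one quotg_inv quotg_mul.
Proof. by elim/quotW=> x; rewrite -pi_quotg_inv -pi_quotg_mul mulVg. Qed.
Lemma quotg_mulxV : right_inverse quotg_one quotg_inv quotg_mul.
Proof. by elim/quotW=> x; rewrite -pi_quotg_inv -pi_quotg_mul mulgV. Qed.

HB.instance Definition _ := isGroup.Build quotg
  quotg_mulA quotg_mul1 quotg_mulx1 quotg_mulVx quotg_mulxV.

End QuotientGroup.

Section Z2.
Variable R : realType.

Definition Z2_pred : {pred sp1 R * sp1 R} :=
  fun p => ((val p.1, val p.2) == (1, 1)) || ((val p.1, val p.2) == (-1, -1)).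

Lemma Z2P (p : sp1 R * sp1 R) : reflect
  ((val p.1 = 1 /\ val p.2 = 1) \/ (val p.1 = -1 /\ val p.2 = -1))
  (p \in Z2_pred).
Proof.
rewrite unfold_in /Z2_pred !xpair_eqE; apply: (iffP orP).
  by case=> /andP[/eqP-> /eqP->]; [left | right].
by case=> -[-> ->]; rewrite !eqxx; [left | right].
Qed.

Lemma quat_conj1 : quat_conj (1 : quat R) = 1.
Proof. by rewrite /quat_conj /= !oppr0. Qed.
Lemma quat_conjN1 : quat_conj (- 1 : quat R) = - 1.
Proof. by congr Quat => /=; rewrite !oppr0. Qed.

Lemma Z2_closed : group_closed Z2_pred.
Proof.
split; first by apply/Z2P; left.
move=> [a b] [c d] /Z2P /= h /Z2P /= h'; apply/Z2P => /=.
by case: h h' => -[-> ->] [] [-> ->]; rewrite ?quat_conj1 ?quat_conjN1 ?mul1r ?mulr1 ?mulN1r ?opprK; auto.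
Qed.

Lemma Z2_conj (x y : sp1 R * sp1 R) : x \in Z2_pred -> (x ^ y)%g \in Z2_pred.
Proof.
have e (u : sp1 R) : quat_conj (val u) * val u = 1.
  exact: (congr1 val (mulVg u)).
case: x y => [a b] [c d] /Z2P /= h; apply/Z2P => /=.
by case: h => -[-> ->]; rewrite ?mul1r ?mulN1r ?mulrN !e; auto.
Qed.

Definition Z2 : normal_subgroup (sp1 R * sp1 R)%type :=
  NormalSubgroup Z2_closed Z2_conj.

End Z2.

Definition isomorphic_groups (G H : groupType) : Prop :=
  exists f : {multiplicative G -> H}, bijective f.

(* Main.v *)
Require Import Defs.
From mathcomp Require Import all_boot reals.
From HB Require Import structures.
From mathcomp Require Import all_order all_algebra ring lra.
From mathcomp Require Import boolp.

(** A pair (u, v) of unit quaternions acts on the Cayley algebra by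
    m + a e4 |-> v m v^-1 + (u a v^-1) e4.  This action preserves the product
    and each of the two summands H and H e4, the eigenspaces of gamma, so it
    defines a homomorphism [spin] from Sp(1) x Sp(1) to the centralizer of gamma
    in G2; the isomorphism is the one that [spin] induces by
    [first_isomorphism].

    Kernel ([spin_eq1P]): if (u, v) acts trivially, then v commutes with every
    quaternion, so v is real of norm 1, that is v = 1 or v = -1; the image u v^-1
    of 1 under the action on H e4 is 1, so u = v.  Both signs occur, as v appears twice
    in the first half and u and v once each in the second.

    Surjectivity ([spin_surj]): an automorphism f that commutes with gamma
    preserves both of its eigenspaces, so f (m + a e4) = beta m + (rho a) e4.
    Here beta is an automorphism of H, hence an inner one,
    beta m = v m v^-1 with v a unit ([quat_skolem_noether]).  As
    m (a e4) = (a m) e4, the map rho satisfies rho m = r (beta m), where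
    r = rho 1, and e4 e4 = -1 forces r to have norm 1.  So f is the action of
    (r v, v). *)

Set Implicit Arguments.
Unset Strict Implicit.
Unset Printing Implicit Defensive.

Import Order.TTheory GRing.Theory Num.Theory.

(** * The first isomorphism theorem *)

Section FirstIsomorphism.
Local Open Scope group_scope.
Local Open Scope quotient_scope.

Lemma first_isomorphism (G H : groupType) (N : normal_subgroup G)
    (phi : UMagmaMorphism.type G H) :
    (forall y, exists x, phi x = y) ->
    (forall x, reflect (phi x = 1) (x \in nsub_pred N)) ->
  isomorphic_groups H (quotg N).
Proof.
move=> phi_surj kerP.
have piP x x' : phi x = phi x' <-> \pi_(quotg N) x = \pi_(quotg N) x'.
  split=> [e | /quotg_eqP/kerP/=].
    by apply/quotg_eqP/kerP; rewrite gmulfM gmulfV e mulVg.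
  by rewrite gmulfM gmulfV => /(canRL (mulVKg _)) ->; rewrite mulg1.
(* The isomorphism H -> G / N is inverse to the map induced by phi: it sends y
   to the class of any preimage of y, all of which lie in one class. *)
pose sec y := sval (cid (phi_surj y)).
have secK y : phi (sec y) = y by rewrite /sec; case: cid.
pose f y := \pi_(quotg N) (sec y).
have f_phi x : f (phi x) = \pi_(quotg N) x by apply/piP; rewrite secK.
have fM : {morph f : y z / y * z}.
  move=> y z; rewrite -[y in LHS]secK -[z in LHS]secK -gmulfM f_phi.
  exact: pi_quotg_mul.
pose fm : {multiplicative H -> quotg N} := HB.pack f
  (isMultiplicative.Build H (quotg N) f fM).
exists fm; exists (fun x => phi (repr x)) => [y | x] /=; last first.
  by rewrite -[RHS]reprK; apply: f_phi.
by rewrite -[RHS]secK; apply/piP; rewrite reprK.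
Qed.

End FirstIsomorphism.

Local Open Scope ring_scope.

(** * Quaternions: centre and automorphisms *)

Section Quaternions.
Variable R : realType.
Implicit Types (x y m q : quat R) (k : R) (u v : sp1 R).

Lemma quat_scalerAl k x y : k *: x * y = k *: (x * y).
Proof. by case: x y => [? ? ? ?] [? ? ? ?]; congr Quat => /=; ring. Qed.

Lemma quat_scalerAr k x y : x * (k *: y) = k *: (x * y).
Proof. by case: x y => [? ? ? ?] [? ? ? ?]; congr Quat => /=; ring. Qed.

Lemma sp1_conjK u : quat_conj (val u) * val u = 1.
Proof. exact: (congr1 val (mulVg u)). Qed.

Definition quat_normsq x : R := q0 x ^+ 2 + q1 x ^+ 2 + q2 x ^+ 2 + q3 x ^+ 2.

Lemma quat_normsq_gt0 x : x != 0 -> 0 < quat_normsq x.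
Proof.
have N0 : 0 <= quat_normsq x by rewrite !addr_ge0 ?sqr_ge0.
rewrite lt_neqAle N0 andbT; apply: contraNneq => /esym /eqP.
rewrite /quat_normsq !paddr_eq0 ?addr_ge0 ?sqr_ge0 // !sqrf_eq0.
by case: x {N0} => a b c d /= /andP[/andP[/andP[/eqP-> /eqP->] /eqP->] /eqP->].
Qed.

Lemma quat_normalize x : x != 0 -> exists k u, k != 0 /\ x = k *: val u.
Proof.
move=> x0; have N0 := quat_normsq_gt0 x0.
pose s := Num.sqrt (quat_normsq x).
have s0 : s != 0 by rewrite sqrtr_eq0 -ltNge.
have s2 : s ^+ 2 = quat_normsq x by rewrite sqr_sqrtr // ltW.
have y1 : quat_norm (s^-1 *: x) == 1.
  rewrite /quat_norm /= !exprMn -!mulrDr -/(quat_normsq x) -s2 exprVn.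
  by rewrite mulVf ?sqrtr1 ?expf_neq0.
by exists s, (Sp1 y1); rewrite /= scalerA divff // scale1r.
Qed.

Lemma quat_eq_opp x : x = - x -> x = 0.
Proof. by case: x => a b c d [h0 h1 h2 h3]; congr Quat; lra. Qed.

Definition e1 : quat R := Quat 0 1 0 0.
Definition e2 : quat R := Quat 0 0 1 0.
Definition e3 : quat R := Quat 0 0 0 1.

Lemma quat_basisE x :
  x = q0 x *: (1 : quat R) + q1 x *: e1 + q2 x *: e2 + q3 x *: e3.
Proof. by case: x => *; congr Quat => /=; ring. Qed.

(** Commuting with e1 kills the e2 and e3 coordinates, commuting with e2 the
    e1 coordinate. *)
Lemma quat_comm_scalar q : (forall m, q * m = m * q) -> q = q0 q *: (1 : quat R).
Proof.
case: q => a b c d h.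
have [_ _ hd hc] := h e1; have [_ _ _ hb] := h e2.
by congr Quat => /=; lra.
Qed.

Lemma sp1_central u : (forall m, val u * m = m * val u) ->
  val u = 1 \/ val u = -1.
Proof.
move=> /quat_comm_scalar hu.
have := elimT (quat_norm1P _) (valP u); rewrite hu => -[/= h _ _ _].
have : (q0 (val u)) ^+ 2 == 1 by apply/eqP; rewrite -[RHS]h /=; ring.
rewrite sqrf_eq1 => /orP[] /eqP ->; first by left; rewrite scale1r.
by right; rewrite scaleN1r.
Qed.

(** The Skolem-Noether theorem for the quaternions.  For any x, the average
    T x = x - beta e1 x e1 - beta e2 x e2 - beta e3 x e3
    of the maps x |-> beta e x e^-1, over e in {1, e1, e2, e3}, intertwines:
    beta m (T x) = (T x) m for all m, because multiplying by a basis element only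
    permutes the terms.  If T vanished on the basis, then summing (T e) e^-1 over e
    would give 0, whereas this sum is 4: conjugating and summing over the basis
    keeps four times the real part of f^-1 in each term beta f (e f^-1 e^-1), and
    only f = 1 contributes.  So T x is nonzero for some x, hence invertible, and its
    normalization is the conjugating unit. *)
Lemma quat_skolem_noether (beta : {linear quat R -> quat R}) :
  {morph beta : x y / x * y} -> beta 1 = 1 ->
  exists u, forall m, beta m = val u * m * quat_conj (val u).
Proof.
move=> bM b1.
pose T x := x - beta e1 * x * e1 - beta e2 * x * e2 - beta e3 * x * e3.
have ee : [/\ e1 * e1 = -1, e2 * e2 = -1, e3 * e3 = -1 &
  [/\ e1 * e2 = e3, e2 * e3 = e1, e3 * e1 = e2 &
  [/\ e2 * e1 = - e3, e3 * e2 = - e1 & e1 * e3 = - e2]]].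
  by do !split; congr Quat => /=; ring.
case: ee => e11 e22 e33 [e12 e23 e31 [e21 e32 e13]].
have T1 x : beta e1 * T x = T x * e1.
  rewrite /T !(mulrBr, mulrBl) !mulrA -!bM -!(mulrA _ _ e1).
  rewrite e11 e12 e13 e21 e31 !linearN b1.
  rewrite !(mulN1r, mulrN1, mulNr, mulrN).
  move: (beta e1 * x) (x * e1) (beta e3 * x * e2) (beta e2 * x * e3).
  by move=> [? ? ? ?] [? ? ? ?] [? ? ? ?] [? ? ? ?]; congr Quat => /=; ring.
have T2 x : beta e2 * T x = T x * e2.
  rewrite /T !(mulrBr, mulrBl) !mulrA -!bM -!(mulrA _ _ e2).
  rewrite e22 e12 e23 e21 e32 !linearN b1.
  rewrite !(mulN1r, mulrN1, mulNr, mulrN).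
  move: (beta e2 * x) (x * e2) (beta e3 * x * e1) (beta e1 * x * e3).
  by move=> [? ? ? ?] [? ? ? ?] [? ? ? ?] [? ? ? ?]; congr Quat => /=; ring.
have Tm x m : beta m * T x = T x * m.
  have T3 : beta e3 * T x = T x * e3.
    by rewrite -e12 bM -mulrA T2 mulrA T1 mulrA.
  move: (T x) (T1 x) (T2 x) T3 => t T1t T2t T3t.
  rewrite (quat_basisE m) !linearD !linearZ /= b1.
  rewrite !(mulrDl, mulrDr) !quat_scalerAl !quat_scalerAr.
  by rewrite T1t T2t T3t mul1r mulr1.
have [x Tx] : exists x, T x != 0.
  apply: contrapT => /forallNP h.
  have {}h x : T x = 0 by apply/eqP/negP => /negP /h.
  (* For e = 1, e1, e2, e3 the e-coordinate of T e = 0 is the real part of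
     (T e) e^-1 = 0; adding the four gives 4 = 0. *)
  move: (h 1) (h e1) (h e2) (h e3); rewrite /T.
  case: (beta e1) (beta e2) (beta e3) => [? ? ? ?] [? ? ? ?] [? ? ? ?].
  move=> [h0 _ _ _] [_ h1 _ _] [_ _ h2 _] [_ _ _ h3].
  by clear -h0 h1 h2 h3; lra.
have [k [u [k0 Tu]]] := quat_normalize Tx.
exists u => m; have := Tm x m; rewrite Tu quat_scalerAl quat_scalerAr.
move=> /(scalerI k0) <-; rewrite -mulrA.
by rewrite (elimT (quat_norm1P _) (valP u)) mulr1.
Qed.

End Quaternions.

(** * The action of pairs of unit quaternions *)

Section Action.
Variable R : realType.
Implicit Types (m n a b : quat R) (x y : cayley R) (p : sp1 R * sp1 R).

Definition spin_fun p x : cayley R :=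
  (val p.2 * x.1 * quat_conj (val p.2), val p.1 * x.2 * quat_conj (val p.2)).

Lemma spin_funM p p' x : spin_fun (p * p')%g x = spin_fun p (spin_fun p' x).
Proof. by rewrite /spin_fun /= !quat_conjM !mulrA. Qed.

Lemma spin_fun1 x : spin_fun 1%g x = x.
Proof. by case: x => m a; rewrite /spin_fun /= quat_conj1 !mul1r !mulr1. Qed.

Lemma spin_fun_linear p : linear (spin_fun p).
Proof.
move=> k [m a] [n b]; rewrite /spin_fun /=.
by congr pair; rewrite /= mulrDr mulrDl quat_scalerAr quat_scalerAl.
Qed.

(** In each of the four products of coordinates, the inner factors u^-1 u or
    v^-1 v cancel. *)
Lemma spin_fun_cayley_mul p : {morph spin_fun p : x y / cayley_mul x y}.
Proof.
case: p => u v [m a] [n b]; rewrite /spin_fun /cayley_mul /=.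
rewrite !quat_conjM !quat_conjK !(mulrBr, mulrBl, mulrDr, mulrDl) !mulrA.
have cvK w : w * quat_conj (val v) * val v = w by rewrite -mulrA sp1_conjK mulr1.
have cuK w : w * quat_conj (val u) * val u = w by rewrite -mulrA sp1_conjK mulr1.
by rewrite !(cvK, cuK).
Qed.

Lemma spin_is_G2 p : is_G2 (spin_fun p).
Proof.
split; [exact: spin_fun_linear | | exact: spin_fun_cayley_mul].
by exists (spin_fun p^-1%g) => x; rewrite -spin_funM ?mulVg ?mulgV spin_fun1.
Qed.

Definition spin_G2 p : G2 R := MkG2 (asboolT (spin_is_G2 p)).

Lemma spin_gamma p : spin_G2 p \in @commutes_gamma R.
Proof.
apply/asboolP/funext => -[m a].
by rewrite /= /spin_fun /= mulrN mulNr.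
Qed.

Definition spin p : G2gamma R := MkG2gamma (spin_gamma p).

Lemma spinM : {morph spin : p p' / (p * p')%g}.
Proof. by move=> p p'; apply/val_inj/G2_eq => x; apply: spin_funM. Qed.

Lemma spin1 : spin 1%g = 1%g.
Proof. by apply/val_inj/G2_eq => x; apply: spin_fun1. Qed.

HB.instance Definition _ := isUMagmaMorphism.Build
  (sp1 R * sp1 R)%type (G2gamma R) spin (spin1, spinM).

Lemma spin_eq1P p : reflect (spin p = 1%g) (p \in Z2_pred (R := R)).
Proof.
apply: (iffP (Z2P p)) => [h | h].
  apply/val_inj/G2_eq => -[m a]; rewrite /= /spin_fun /=.
  case: h => -[-> ->]; rewrite ?quat_conj1 ?quat_conjN1 ?mul1r ?mulr1 //.
  by rewrite !mulrN1 !mulN1r !opprK.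
have fixx x : spin_fun p x = x := congr1 (fun f : G2gamma R => f x) h.
have act2 m : val p.2 * m = m * val p.2.
  have /= e := congr1 fst (fixx (m, 0)).
  by rewrite -{2}[m]e -mulrA sp1_conjK mulr1.
have e12 : val p.1 = val p.2.
  have /= e := congr1 snd (fixx (0, 1)).
  by rewrite -[RHS]mul1r -{1}e mulr1 -mulrA sp1_conjK mulr1.
by rewrite e12; case: (sp1_central act2) => ->; [left | right].
Qed.

Lemma commutes_gammaE (f : G2gamma R) x : gamma (f x) = f (gamma x).
Proof. by have /asboolP/funeqP/(_ x) := valP f. Qed.

(** H is the fixed space of gamma and H e4 its (-1)-eigenspace, so a linear map
    commuting with gamma preserves both. *)
Lemma gamma_eigenspaces (f : G2gamma R) m a :
  (f (m, 0)).2 = 0 /\ (f (0, a)).1 = 0.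
Proof.
have [flin _ _] := G2P f.
have fN x : f (- x) = - f x.
  have f0 : f 0 = 0.
    by rewrite -[X in f X](subrr 0) -scaleN1r addrC flin scaleN1r addNr.
  by rewrite -[- x]addr0 -scaleN1r flin f0 scaleN1r addr0.
have := commutes_gammaE f (0, a); have := commutes_gammaE f (m, 0).
have -> : gamma (m, 0) = (m, 0) :> cayley R by rewrite /= oppr0.
have -> : gamma (0, a) = - (0, a) :> cayley R by congr pair; rewrite /= oppr0.
rewrite fN; case: (f (m, 0)) (f (0, a)) => [m1 a1] [m2 a2] /=.
by move=> [/esym/quat_eq_opp ->] [/quat_eq_opp ->].
Qed.

Lemma spin_surj (f : G2gamma R) : exists p, spin p = f.
Proof.
have [flin [g fK gK] fM] := G2P f.
pose beta m := (f (m, 0)).1; pose rho a := (f (0, a)).2.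
have fl m : f (m, 0) = (beta m, 0).
  by have [e _] := gamma_eigenspaces f m 0; rewrite [LHS]surjective_pairing e.
have fr a : f (0, a) = (0, rho a).
  by have [_ e] := gamma_eigenspaces f 0 a; rewrite [LHS]surjective_pairing e.
have conj0 : quat_conj 0 = 0 :> quat R by rewrite /quat_conj /= oppr0.
have beta_linear : linear beta.
  move=> k m n; rewrite /beta.
  have -> : (k *: m + n, 0) = k *: ((m, 0) : cayley R) + (n, 0) :> cayley R.
    by congr pair; rewrite /= scaler0 addr0.
  by rewrite flin.
have betaM : {morph beta : m n / m * n}.
  move=> m n; have /(congr1 fst) := fM (m, 0) (n, 0).
  by rewrite !fl /= !(mulr0, mul0r, conj0) !subr0 addr0 fl.
(* Left multiplication by m on H e4 is right multiplication on coordinates: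
   m (a e4) = (a m) e4. *)
have rhoM a m : rho (a * m) = rho a * beta m.
  have /(congr1 snd) := fM (m, 0) (0, a).
  by rewrite fl fr /= !(mulr0, mul0r) subr0 !add0r fr.
(* beta 1 is a right identity for the values of f, and one of these is 1. *)
have [c fc] : exists c, f c = (1, 0) by exists (g (1, 0)); rewrite gK.
have beta1 : beta 1 = 1.
  have /(congr1 fst) := fM c (1, 0); rewrite fl fc.
  case: c fc => c d fc /=; rewrite !(mulr0, mul0r, mulr1, mul1r, conj0).
  by rewrite !subr0 quat_conj1 mulr1 addr0 fc.
pose betal : {linear quat R -> quat R} := HB.pack beta
  (GRing.isLinear.Build R (quat R) (quat R) *:%R beta beta_linear).
have [v betaE] := quat_skolem_noether (beta := betal) betaM beta1.
(* Apply f to e4 e4 = -1. *)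
have rho1 : quat_norm (rho 1) == 1.
  have /(congr1 fst) /= := fM (0, 1) (0, 1).
  rewrite !fr /= !(mulr0, mul0r, mulr1, conj0, quat_conj1) !sub0r addr0 fl /=.
  rewrite -[beta _]/(betal _) linearN /= beta1 => /oppr_inj h.
  by rewrite -quat_norm_conj; apply/quat_norm1P; rewrite quat_conjK -h.
have f_split m a : f (m, a) = (beta m, rho a).
  have -> : (m, a) = 1 *: ((m, 0) : cayley R) + (0, a) :> cayley R.
    by rewrite scale1r; congr pair; rewrite /= ?addr0 ?add0r.
  by rewrite flin scale1r fl fr; congr pair; rewrite /= ?addr0 ?add0r.
exists (Sp1 rho1 * v, v)%g; apply/val_inj/G2_eq => -[m a].
rewrite [RHS]f_split -[a in RHS]mul1r rhoM.
by congr pair; rewrite -[beta _]/(betal _) betaE //= !mulrA.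
Qed.

End Action.

Theorem theorem1p10p1 (R : realType) :
  isomorphic_groups (G2gamma R) (quotg (Z2 R)).
Proof.
exact: (first_isomorphism (N := Z2 R) (@spin_surj R) (@spin_eq1P R)).
Qed.
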